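(* Let $n$ be a positive integer. There exists a strongly cancellative set of size $2^{\lfloor n/2\rfloor}$ on the Boolean lattice $B_n$.
   Context: The Boolean lattice $B_n$ is the lattice of all subsets of $\{1,\ldots,n\}$ ordered by inclusion, so that $a\wedge b = a\cap b$ and $a\vee b = a\cup b$. A strongly cancellative set of (or on) a lattice $L$ is a subset $C$ of the points of $L$ such that for any three different points $a_1,a_2,a_3\in C$, $a_1\wedge a_2\neq a_1\wedge a_3$ and $a_1\vee a_2\neq a_1\vee a_3$. *)

(* Defs.v *)
From mathcomp Require Import all_boot all_order.

(* Makes inclusion the canonical order on {set T}, with meet :&: and join :|:. *)
Export Order.DefaultSetSubsetOrder.

Set Implicit Arguments.
Unset Strict Implicit.
Unset Printing Implicit Defensive.

Local Open Scope order_scope.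

Definition strongly_cancellative (d : Order.disp_t) (L : latticeType d)
    (C : {pred L}) : Prop :=
  forall a1 a2 a3 : L, a1 \in C -> a2 \in C -> a3 \in C ->
    a1 <> a2 -> a1 <> a3 -> a2 <> a3 ->
    a1 `&` a2 <> a1 `&` a3 /\ a1 `|` a2 <> a1 `|` a3.

(* 'I_n = {0, ..., n-1} plays the role of {1, ..., n}. *)
Notation boolean_lattice n := {set 'I_n}.

(* Main.v *)
Require Import Defs.
From mathcomp Require Import all_boot all_order.

(** Split [2 * (n %/ 2)] of the [n] points into [n %/ 2] disjoint pairs, and
    take for [C] all the sets that contain exactly one point of each pair and
    nothing else; such a set is a choice of one bit per pair, so that there are
    [2 ^ (n %/ 2)] of them. The meet of [a1] and [a2] has a point in a given
    pair exactly when [a1] and [a2] choose the same point there, and their join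
    contains the whole pair exactly when they choose differently. So [a1]
    together with either [a1 :&: a2] or [a1 :|: a2] tells where [a2] agrees with
    [a1]; a choice being binary, this determines [a2]. Hence the meets, and also
    the joins, of [a1] with two other members of [C] are distinct
    ([transversals_cancellative]). *)

Section Transversals.

Variables (I T : finType) (f : I + I -> T).
Hypothesis f_inj : injective f.

(** The two elements of the pair indexed by [i] are [f (inl i)] and
    [f (inr i)]; the set [S] records where the first one is chosen. *)
Definition transversal (S : {set I}) : {set T} :=
  f @: [set u | match u with inl i => i \in S | inr i => i \notin S end].

Lemma transversal_inl S i : (f (inl i) \in transversal S) = (i \in S).
Proof. by rewrite mem_imset // inE. Qed.

Lemma transversal_inr S i : (f (inr i) \in transversal S) = (i \notin S).
Proof. by rewrite mem_imset // inE. Qed.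

Lemma transversal_inj : injective transversal.
Proof. by move=> S1 S2 eqS; apply/setP=> i; rewrite -!transversal_inl eqS. Qed.

(** If [i] is in [S1], then [f (inl i)] is in the meet exactly when [i] is in
    the other set; otherwise [f (inr i)] plays the same part. *)
Lemma transversal_meet_inj S1 S2 S3 :
  transversal S1 :&: transversal S2 = transversal S1 :&: transversal S3 ->
  S2 = S3.
Proof.
move=> /setP eqI; apply/setP=> i.
move: (eqI (f (inl i))) (eqI (f (inr i))).
rewrite !in_setI !transversal_inl !transversal_inr.
by case: (i \in S1) (i \in S2) (i \in S3) => [] [] [].
Qed.

(** Dual to [transversal_meet_inj]: the informative point of each pair is now
    the one that [S1] does not choose. *)
Lemma transversal_join_inj S1 S2 S3 :
  transversal S1 :|: transversal S2 = transversal S1 :|: transversal S3 ->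
  S2 = S3.
Proof.
move=> /setP eqU; apply/setP=> i.
move: (eqU (f (inl i))) (eqU (f (inr i))).
rewrite !in_setU !transversal_inl !transversal_inr.
by case: (i \in S1) (i \in S2) (i \in S3) => [] [] [].
Qed.

Definition transversals : {set {set T}} := transversal @: [set: {set I}].

Lemma card_transversals : #|transversals| = 2 ^ #|I|.
Proof.
by rewrite card_imset; [rewrite -powersetT card_powerset cardsT |
  exact: transversal_inj].
Qed.

Lemma transversals_cancellative : strongly_cancellative transversals.
Proof.
move=> _ _ _ /imsetP[S1 _ ->] /imsetP[S2 _ ->] /imsetP[S3 _ ->] _ _ neq23.
by split=> [/transversal_meet_inj | /transversal_join_inj] eq23;
  apply: neq23; rewrite eq23.
Qed.

End Transversals.

Theorem theorem4p1 (n : nat) (hn : 0 < n) :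
  exists C : {set boolean_lattice n},
    strongly_cancellative C /\ #|C| = 2 ^ (n %/ 2).
Proof.
have le_mm_n : n %/ 2 + n %/ 2 <= n by rewrite addnn -muln2 leq_divM.
(* The [i]-th pair consists of the points [i] and [n %/ 2 + i]. *)
pose f (u : 'I_(n %/ 2) + 'I_(n %/ 2)) := widen_ord le_mm_n (unsplit u).
have f_inj : injective f.
  move=> u v /(congr1 val) eq_uv; apply: (can_inj (@unsplitK _ _)).
  exact: val_inj.
exists (transversals _ _ f); split; first exact: transversals_cancellative.
by rewrite card_transversals // card_ord.
Qed.
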